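(* Let $a,b\in\mathbb{R}$ with $0<b\le a$ and $ab=1$, and let $R=[-\frac a2,\frac a2]\times[-\frac b2,\frac b2]$. For every $\Lambda>a+b$ there exists $\tau_0=\tau_0(\Lambda)>0$ such that for every $\tau\in(0,\tau_0)$ the problem $$\min\Big\{\mathrm P_{|\cdot|_1}(\tilde R)+\tfrac1\tau\mathcal D(\tilde R,R):\ \tilde R\subset\mathbb{R}^2\text{ an axis-parallel rectangle},\ |\tilde R|=1,\ \mathrm{Bar}(\tilde R)=0\Big\}$$ has a unique minimizer $R'$. Moreover $R'=[-\frac{a'}2,\frac{a'}2]\times[-\frac{b'}2,\frac{b'}2]$ with $$a'=a-2x(\tau),\quad x(\tau)=x'\tau+O(\tau^2),\quad x'=\frac{2(a-b)}{b(a+b)},\qquad b'=b+2y(\tau),\quad y(\tau)=\frac{b\,x(\tau)}{a-2x(\tau)},$$ and $$a'+b'\le a+b,\quad |a'-a|\le \tau C(\Lambda),\quad |b'-b|\le\tau C(\Lambda),\quad |R\triangle R'|\le \tau C(\Lambda),$$ where $C(\Lambda)$ denotes a constant depending only on $\Lambda$.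
   Context: $|\nu|_1=|\nu_1|+|\nu_2|$, $|z|_\infty=\max\{|z_1|,|z_2|\}$. For a set of finite perimeter $E$, $\mathrm P_{|\cdot|_1}(E)=\int_{\partial^*E}|\nu_E|_1\,d\mathcal H^1$; for a rectangle with sides $\alpha,\beta$ this equals $2\alpha+2\beta$. $d_\infty(z,\partial F)=\inf\{|z-\hat z|_\infty:\hat z\in\partial F\}$, $\mathcal D(E,F)=\int_{E\triangle F}d_\infty(z,\partial F)\,dz$, $\mathrm{Bar}(E)=\int_Ex\,dx$. $O(g)$ denotes a function bounded in absolute value by a constant times $|g|$. *)

(* Defs.v *)
From HB Require Import structures.
From mathcomp Require Import all_boot all_order all_algebra.
From mathcomp Require Import all_classical all_reals all_analysis.
Set Implicit Arguments. Unset Strict Implicit. Unset Printing Implicit Defensive.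
Import Order.TTheory GRing.Theory Num.Theory.
Import numFieldNormedType.Exports.
Local Open Scope classical_set_scope.
Local Open Scope ring_scope.

Section Defs.
Variable R : realType.

Definition leb2 := ((@lebesgue_measure R) \x (@lebesgue_measure R))%E.

Definition rect (c1 c2 al be : R) : set (R * R) :=
  [set z | `|z.1 - c1| <= al / 2 /\ `|z.2 - c2| <= be / 2].

Definition symdiff (E F : set (R * R)) : set (R * R) := (E `\` F) `|` (F `\` E).

Definition boundary (F : set (R * R)) : set (R * R) := closure F `\` interior F.

Definition dinf (z : R * R) (F : set (R * R)) : R :=
  inf [set Num.max `|z.1 - w.1| `|z.2 - w.2| | w in boundary F].

Definition Dist (E F : set (R * R)) : \bar R :=
  (\int[leb2]_(z in symdiff E F) (dinf z F)%:E)%E.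

Definition bar1 (E : set (R * R)) : \bar R := (\int[leb2]_(z in E) (z.1)%:E)%E.
Definition bar2 (E : set (R * R)) : \bar R := (\int[leb2]_(z in E) (z.2)%:E)%E.

Definition perim_rect (al be : R) : R := 2 * al + 2 * be.

Definition admissible (c1 c2 al be : R) : Prop :=
  0 < al /\ 0 < be /\ leb2 (rect c1 c2 al be) = 1%E /\
  bar1 (rect c1 c2 al be) = 0%E /\ bar2 (rect c1 c2 al be) = 0%E.

Definition energy (tau : R) (F : set (R * R)) (c1 c2 al be : R) : \bar R :=
  ((perim_rect al be)%:E + (tau^-1)%:E * Dist (rect c1 c2 al be) F)%E.

End Defs.

(* Main.v *)
(* An admissible rectangle is centred at the origin, so it is determined by its
   width al = a - 2 x, and al be = 1. If al > a the perimeter alone already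
   exceeds that of R. For 0 <= 2 x <= b the dissipation is the explicit function
   b x^2 - (2/3) x^3 + b^2 x^2 / (a - 2 x), and the energy is strictly convex in
   x; for 2 x > b the dissipation is at least b^3 / 6, which is too expensive
   once 24 tau <= b^4. Hence a zero of the derivative of the energy in
   [0, 4 tau / b], which exists by the intermediate value theorem, is the unique
   minimizer, and linearizing the vanishing derivative at 0 gives the expansion
   of x. Since a < Lam and a b = 1, all constants are controlled by Lam. *)
Require Import Defs.
From HB Require Import structures.
From mathcomp Require Import all_boot all_order all_algebra.
From mathcomp Require Import all_classical all_reals all_analysis.
From mathcomp Require Import measurable_realfun ring lra.
Set Implicit Arguments. Unset Strict Implicit. Unset Printing Implicit Defensive.
Import Order.TTheory GRing.Theory Num.Theory.
Import numFieldNormedType.Exports.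
Local Open Scope classical_set_scope.
Local Open Scope ring_scope.

(** * One-dimensional integrals of piecewise polynomials *)

Lemma integral_itv_deriv (R : realType) (p : {poly R}) (f : R -> R) (u v : R) :
  u <= v -> (forall t, u <= t <= v -> f t = (p^`()).[t]) ->
  (\int[lebesgue_measure]_(t in `[u, v]) (f t)%:E = (p.[v] - p.[u])%:E)%E.
Proof.
move=> uv fE.
transitivity (\int[lebesgue_measure]_(t in `[u, v]) ((p^`()).[t])%:E)%E.
  by apply: eq_integral => t; rewrite inE /= in_itv /= => /fE ->.
(* The fundamental theorem of calculus is applied with [u < v], so the degenerate interval is
   treated apart. *)
move: uv; rewrite le_eqVlt => /orP[/eqP ->|uv].
  by rewrite set_itv1 integral_set1 subrr.
rewrite (@continuous_FTC2 R (horner p^`()) (horner p) u v uv) ?EFinB//.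
- apply: continuous_subspaceT; exact: continuous_horner.
- split; first by move=> t _; exact: derivable_horner.
  + apply: cvg_at_right_filter; exact: continuous_horner.
  + apply: cvg_at_left_filter; exact: continuous_horner.
- by move=> t _; rewrite -derivE.
Qed.

(** Agreement with the quadratic is asked on [[u, v]] only, so that integrands with absolute values
    and minima can be resolved piece by piece. *)
Lemma integral_itv_quad (R : realType) (c0 c1 c2 : R) (f : R -> R) (u v : R) :
  u <= v -> (forall t, u <= t <= v -> f t = c0 + c1 * t + c2 * t ^+ 2) ->
  (\int[lebesgue_measure]_(t in `[u, v]) (f t)%:E =
   (c0 * (v - u) + c1 * (v ^+ 2 - u ^+ 2) / 2 + c2 * (v ^+ 3 - u ^+ 3) / 3)%:E)%E.
Proof.
move=> uv fE.
pose p : {poly R} := c0 *: 'X + (c1 / 2) *: 'X ^+ 2 + (c2 / 3) *: 'X ^+ 3.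
rewrite (@integral_itv_deriv R p)//; last first.
  by move=> t /fE ->; rewrite /p !poly.derivE !hornerE /=; field.
by congr (_%:E); rewrite /p !hornerE /=; field.
Qed.

Lemma integral_itv_split (R : realType) (f : R -> R) (u v w : R) :
  measurable_fun setT f -> u <= v -> v <= w ->
  (\int[lebesgue_measure]_(t in `[u, w]) (f t)%:E =
   \int[lebesgue_measure]_(t in `[u, v]) (f t)%:E +
   \int[lebesgue_measure]_(t in `[v, w]) (f t)%:E)%E.
Proof.
move=> mf uv vw.
have mfE D : measurable_fun D (EFin \o f).
  by apply: measurable_funTS; exact/measurable_EFinP.
rewrite (@itv_bndbnd_setU _ _ _ (BRight v)) ?bnd_simp// integral_setU//.
- by rewrite integral_itv_obnd_cbnd//; exact: mfE.
- exact: mfE.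
- apply/disj_setPS => t /= []; rewrite !in_itv /= => /andP[_ tv] /andP[vt _].
  lra.
Qed.

Lemma shellE (R : realType) (h k : R) : 0 <= h ->
  [set t : R | h < `|t| <= k] = `[- k, - h[ `|` `]h, k].
Proof.
move=> h0; apply/seteqP; split=> t /=; rewrite !in_itv /=.
  move=> /andP[]; rewrite lter_norml ltr_normr => /orP[ht|ht] /andP[tk kt].
    by right; rewrite ht.
  by left; rewrite tk /=; lra.
by move=> [|] /andP[H1 H2]; apply/andP; split;
  rewrite ?ltr_normr ?ler_norml; try apply/orP; try apply/andP; lra.
Qed.

Lemma measurable_shell (R : realType) (h k : R) : 0 <= h ->
  measurable [set t : R | h < `|t| <= k].
Proof. by move=> h0; rewrite shellE//; apply: measurableU. Qed.

(** Endpoints are null sets, so both half-open components can be closed, which is the form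
    [integral_itv_quad] expects. *)
Lemma integral_shell (R : realType) (f : R -> R) (h k : R) :
  measurable_fun setT f -> 0 <= h ->
  (\int[lebesgue_measure]_(t in [set t | (h < `|t| <= k)%R]) (f t)%:E =
   \int[lebesgue_measure]_(t in `[(- k)%R, (- h)%R]) (f t)%:E +
   \int[lebesgue_measure]_(t in `[h, k]) (f t)%:E)%E.
Proof.
move=> mf h0.
have mfE D : measurable_fun D (EFin \o f).
  by apply: measurable_funTS; exact/measurable_EFinP.
rewrite shellE// integral_setU//.
- by rewrite integral_itv_obnd_cbnd ?integral_itv_bndo_bndc//; exact: mfE.
- exact: mfE.
- apply/disj_setPS => t /= []; rewrite !in_itv /= => /andP[_ th] /andP[ht _].
  lra.
Qed.

(** * Iterated integrals over product sets *)

(** Tonelli for the extension of [f] by zero: its section at [x] is the restriction to [B] when [x]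
    is in [A], and vanishes otherwise. *)
Lemma integral_setX_ge0 (R : realType) d1 d2 (T1 : measurableType d1)
    (T2 : measurableType d2) (m1 : {sigma_finite_measure set T1 -> \bar R})
    (m2 : {sigma_finite_measure set T2 -> \bar R})
    (A : set T1) (B : set T2) (f : T1 * T2 -> \bar R) :
  measurable A -> measurable B -> measurable_fun (A `*` B) f ->
  (forall z, (A `*` B) z -> (0 <= f z)%E) ->
  (\int[m1 \x m2]_(z in A `*` B) f z =
   \int[m1]_(x in A) \int[m2]_(y in B) f (x, y))%E.
Proof.
move=> mA mB mf f0; have mAB : measurable (A `*` B) by exact: measurableX.
rewrite integral_mkcond fubini_tonelli1/=; last 2 first.
- by apply/(measurable_restrictT _ mAB).
- by move=> z; rewrite patchE; case: ifPn => // /set_mem /f0.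
rewrite [RHS]integral_mkcond; apply: eq_integral => x _.
rewrite /fubini_F patchE; case: ifPn => xA.
  rewrite [RHS]integral_mkcond; apply: eq_integral => y _ /=.
  by rewrite !patchE in_setX /= xA.
rewrite integral0_eq// => y _.
by rewrite patchE in_setX /= (negbTE xA).
Qed.

(** The Fubini counterpart for integrands of varying sign, as in the barycentre. *)
Lemma integral_setX (R : realType) d1 d2 (T1 : measurableType d1)
    (T2 : measurableType d2) (m1 : {sigma_finite_measure set T1 -> \bar R})
    (m2 : {sigma_finite_measure set T2 -> \bar R})
    (A : set T1) (B : set T2) (f : T1 * T2 -> \bar R) :
  measurable A -> measurable B -> (m1 \x m2)%E.-integrable (A `*` B) f ->
  (\int[m1 \x m2]_(z in A `*` B) f z =
   \int[m1]_(x in A) \int[m2]_(y in B) f (x, y))%E.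
Proof.
move=> mA mB intf; have mAB : measurable (A `*` B) by exact: measurableX.
rewrite integral_mkcond -integral12_prod_meas1/=; last first.
  exact/(integrable_mkcond _ mAB).
rewrite [RHS]integral_mkcond; apply: eq_integral => x _.
rewrite /fubini_F patchE; case: ifPn => xA.
  rewrite [RHS]integral_mkcond; apply: eq_integral => y _ /=.
  by rewrite !patchE in_setX /= xA.
rewrite integral0_eq// => y _.
by rewrite patchE in_setX /= (negbTE xA).
Qed.

(** * The boundary of a rectangle and the distance to it *)

Lemma rectE (R : realType) (c1 c2 al be : R) :
  rect c1 c2 al be =
  `[c1 - al / 2, c1 + al / 2] `*` `[c2 - be / 2, c2 + be / 2].
Proof.
by apply/seteqP; split=> -[x y] /=; rewrite /rect /= !in_itv /= !ler_distl.
Qed.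

Lemma boundary_rectP (R : realType) (a b : R) (w : R * R) :
  0 <= a -> 0 <= b ->
  boundary (rect 0 0 a b) w <->
  [/\ `|w.1| <= a / 2, `|w.2| <= b / 2 & `|w.1| = a / 2 \/ `|w.2| = b / 2].
Proof.
move=> a0 b0; case: w => w1 w2.
have clR : closed (rect 0 0 a b).
  rewrite rectE (_ : _ `*` _ = fst @^-1` `[0 - a / 2, 0 + a / 2] `&`
    snd @^-1` `[0 - b / 2, 0 + b / 2])//.
  apply: closedI; apply: closed_comp.
  - by move=> z _; exact: cvg_fst.
  - exact: itv_closed.
  - by move=> z _; exact: cvg_snd.
  - exact: itv_closed.
rewrite /boundary -(closure_id _).1//; split=> /=.
  case=> -[/= wa wb] nint; move: wa wb; rewrite !subr0 => wa wb; split=> //.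
  apply: contrapT => /not_orP[/eqP na /eqP nb]; apply: nint.
  have {na}wa' : `|w1| < a / 2 by rewrite lt_neqAle na.
  have {nb}wb' : `|w2| < b / 2 by rewrite lt_neqAle nb.
  (* Balls of the product are sup-norm balls, so the smaller of the two gaps to the sides is an
     admissible radius. *)
  apply/nbhs_ballP; exists (Num.min (a / 2 - `|w1|) (b / 2 - `|w2|)) => /=.
    by rewrite lt_min !subr_gt0 wa'.
  move=> [x y] [/= bx bY]; rewrite /rect /= !subr0.
  have {}bx : `|w1 - x| < Num.min (a / 2 - `|w1|) (b / 2 - `|w2|) := bx.
  have {}bY : `|w2 - y| < Num.min (a / 2 - `|w1|) (b / 2 - `|w2|) := bY.
  move: bx bY; rewrite !lt_min => /andP[bx _] /andP[_ bY].
  have := lerB_dist x w1; have := lerB_dist y w2.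
  rewrite [`|x - _|]distrC [`|y - _|]distrC => dy dx.
  by split; [have := le_lt_trans dx bx|have := le_lt_trans dy bY];
    rewrite ltrD2r => /ltW.
move=> [wa wb wab]; split; first by rewrite /rect /= !subr0.
move=> /nbhs_ballP[e /= e0 sub].
have [h0 he] : 0 < e / 2 /\ e / 2 < e.
  by rewrite divr_gt0//= ltr_pdivrMr// ltr_pMr// ltr1n.
set h := e / 2 in h0 he.
(* Pushing a coordinate away from the origin by [e / 2] stays in the ball and strictly increases its
   modulus; for a point on a side this leaves the rectangle. *)
have grow (t : R) : exists2 t', ball t e t' & `|t| < `|t'|.
  have [t0|t0] := lerP 0 t.
  - exists (t + h); last by rewrite !ger0_norm ?ltrDl// addr_ge0// ltW.
    by change (`|t - (t + h)| < e); rewrite opprD addrA subrr add0r normrN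
      gtr0_norm.
  - exists (t - h); last by rewrite !ltr0_norm ?opprB ?ltrDr// ?subr_lt0 ?(lt_trans t0)// addrC ltrDl.
    by change (`|t - (t - h)| < e); rewrite opprB addrCA subrr addr0
      gtr0_norm.
case: wab => [wa'|wb'].
- have [t bt wt] := grow w1.
  have /sub : ball (w1, w2) e (t, w2) by split=> //=; exact: ballxx.
  by rewrite /rect /= !subr0 => -[+ _]; rewrite -wa' leNgt wt.
- have [t bt wt] := grow w2.
  have /sub : ball (w1, w2) e (w1, t) by split=> //=; exact: ballxx.
  by rewrite /rect /= !subr0 => -[_ +]; rewrite -wb' leNgt wt.
Qed.

Lemma dinf_le (R : realType) (F : set (R * R)) (z w : R * R) :
  boundary F w -> dinf z F <= Num.max `|z.1 - w.1| `|z.2 - w.2|.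
Proof.
move=> Fw; apply: ge_inf; last by exists w.
by exists 0 => _ [v _ <-]; rewrite le_max normr_ge0.
Qed.

Lemma dinf_ge0 (R : realType) (F : set (R * R)) (z : R * R) : 0 <= dinf z F.
Proof.
(* With an empty boundary, [dinf] takes the default value 0 of [inf] on the empty set. *)
have [F0|/set0P Fn0] := eqVneq (boundary F) set0.
  by rewrite /dinf F0 image_set0 inf0.
apply: lb_le_inf => [|_ [v _ <-]]; last by rewrite le_max normr_ge0.
by case: Fn0 => w Fw; exists (Num.max `|z.1 - w.1| `|z.2 - w.2|), w.
Qed.

(** Here [u] is the one of [h] and [- h] on the same side of the origin as [t]. *)
Lemma norm_proj (R : realType) (t h : R) : 0 <= h ->
  exists2 u, `|u| = h & `|t - u| = `| `|t| - h|.
Proof.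
move=> h0; have [t0|t0] := lerP 0 t.
- by exists h; [exact: ger0_norm|rewrite (ger0_norm t0)].
- exists (- h); first by rewrite normrN ger0_norm.
  by rewrite (ltr0_norm t0) -opprD normrN opprK.
Qed.

(** The competitor in the infimum is the point at the height of [z] on the nearer vertical side. *)
Lemma dinf_rect_le1 (R : realType) (a b : R) (z : R * R) : 0 <= a -> 0 <= b ->
  `|z.2| <= b / 2 -> dinf z (rect 0 0 a b) <= `| `|z.1| - a / 2|.
Proof.
move=> a0 b0 zb; have [|u uE zu] := @norm_proj _ z.1 (a / 2); first by rewrite divr_ge0.
have /(dinf_le z)/le_trans-> //= : boundary (rect 0 0 a b) (u, z.2).
  by apply/boundary_rectP => //=; rewrite uE; split => //; left.
by rewrite subrr normr0 zu ge_max lexx normr_ge0.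
Qed.

Lemma dinf_rect_le2 (R : realType) (a b : R) (z : R * R) : 0 <= a -> 0 <= b ->
  `|z.1| <= a / 2 -> dinf z (rect 0 0 a b) <= `| `|z.2| - b / 2|.
Proof.
move=> a0 b0 za; have [|u uE zu] := @norm_proj _ z.2 (b / 2); first by rewrite divr_ge0.
have /(dinf_le z)/le_trans-> //= : boundary (rect 0 0 a b) (z.1, u).
  by apply/boundary_rectP => //=; rewrite uE; split => //; right.
by rewrite subrr normr0 zu ge_max lexx normr_ge0.
Qed.

Lemma boundary_rect_neq0 (R : realType) (a b : R) : 0 <= a -> 0 <= b ->
  boundary (rect 0 0 a b) !=set0.
Proof.
move=> a0 b0; exists (a / 2, b / 2); apply/boundary_rectP => //=.
by rewrite !ger0_norm ?divr_ge0//; split=> //; left.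
Qed.

Lemma le_dinf_rect (R : realType) (a b m : R) (z : R * R) :
  0 <= a -> 0 <= b ->
  (forall w, boundary (rect 0 0 a b) w ->
     m <= Num.max `|z.1 - w.1| `|z.2 - w.2|) ->
  m <= dinf z (rect 0 0 a b).
Proof.
move=> a0 b0 mle; apply: lb_le_inf => [|_ [w /mle + <-]//].
by have [w Fw] := boundary_rect_neq0 a0 b0;
  exists (Num.max `|z.1 - w.1| `|z.2 - w.2|), w.
Qed.

(** Vertical projection gives the upper bound. Boundary points have second coordinate at most
    [b / 2] in modulus, which gives the lower one. *)
Lemma dinf_rect_above (R : realType) (a b : R) (z : R * R) :
  0 <= a -> 0 <= b -> `|z.1| <= a / 2 -> b / 2 <= `|z.2| ->
  dinf z (rect 0 0 a b) = `|z.2| - b / 2.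
Proof.
move=> a0 b0 za zb; apply/le_anti/andP; split.
  have := dinf_rect_le2 a0 b0 za; rewrite ger0_norm// subr_ge0//.
apply: le_dinf_rect => // w /boundary_rectP[]// _ wb _.
have dist2 := lerB_dist z.2 w.2; rewrite le_max; apply/orP; right; lra.
Qed.

(** The two projections give the upper bound. A boundary point lies on a vertical or on a horizontal
    side, and the reverse triangle inequality in that coordinate gives the lower one. *)
Lemma dinf_rect_inside (R : realType) (a b : R) (z : R * R) :
  0 <= a -> 0 <= b -> `|z.1| <= a / 2 -> `|z.2| <= b / 2 ->
  dinf z (rect 0 0 a b) = Num.min (a / 2 - `|z.1|) (b / 2 - `|z.2|).
Proof.
move=> a0 b0 za zb; apply/le_anti/andP; split.
  rewrite le_min -[_ - `|z.1|]ger0_norm ?subr_ge0// distrC dinf_rect_le1//.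
  by rewrite -[_ - `|z.2|]ger0_norm ?subr_ge0// distrC dinf_rect_le2.
apply: le_dinf_rect => // w /boundary_rectP[]// _ _ [wa|wb].
- by rewrite ge_min !le_max -wa distrC lerB_dist.
- by rewrite ge_min !le_max -wb [`|z.2 - _|]distrC lerB_dist !orbT.
Qed.

(** * Area and barycentre of rectangles *)

Lemma lebesgue_measure_itvcc (R : realType) (u v : R) : u <= v ->
  lebesgue_measure `[u, v] = (v - u)%:E.
Proof.
move=> uv; have := @integral_itv_quad R 1 0 0 (cst 1) u v uv.
rewrite /cst integral_cst//= mul1e => ->; last by move=> t _; rewrite !mul0r !addr0.
by congr EFin; rewrite !mul0r !addr0 mul1r.
Qed.

Lemma measurable_rect (R : realType) (c1 c2 al be : R) :
  measurable (rect c1 c2 al be).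
Proof. by rewrite rectE; exact: measurableX. Qed.

Lemma leb2_rect (R : realType) (c1 c2 al be : R) : 0 <= al -> 0 <= be ->
  leb2 (rect c1 c2 al be) = (al * be)%:E.
Proof.
move=> al0 be0; rewrite rectE.
transitivity (lebesgue_measure `[(c1 - al / 2)%R, (c1 + al / 2)%R] *
  lebesgue_measure `[(c2 - be / 2)%R, (c2 + be / 2)%R])%E.
  exact: product_measure1E.
rewrite !lebesgue_measure_itvcc; [|lra|lra].
by rewrite -EFinM; congr (_%:E); field.
Qed.

Lemma integrable_rect (R : realType) (c1 c2 al be M : R) (f : R * R -> R) :
  0 <= al -> 0 <= be -> measurable_fun setT f ->
  (forall z, rect c1 c2 al be z -> `|f z| <= M) ->
  (@leb2 R).-integrable (rect c1 c2 al be) (EFin \o f).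
Proof.
move=> al0 be0 mf fM; apply: measurable_bounded_integrable.
- exact: measurable_rect.
- have ltoo : (leb2 (rect c1 c2 al be) < +oo)%E by rewrite leb2_rect// ltry.
  exact: ltoo.
- exact: measurable_funTS.
- exists M; split=> [|m Mm z /fM fz]; first exact: num_real.
  exact: le_trans fz (ltW Mm).
Qed.

Lemma integral_itv_id (R : realType) (c h : R) : 0 <= h ->
  (\int[lebesgue_measure]_(t in `[(c - h / 2)%R, (c + h / 2)%R]) t%:E = (c * h)%:E)%E.
Proof.
move=> h0; rewrite (@integral_itv_quad R 0 1 0 id); [|lra|].
- by congr (_%:E); field.
- by move=> t _; rewrite mul0r mul1r add0r addr0.
Qed.

Lemma bar1_rect (R : realType) (c1 c2 al be : R) : 0 <= al -> 0 <= be ->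
  bar1 (rect c1 c2 al be) = (c1 * al * be)%:E.
Proof.
move=> al0 be0.
have intf : (@leb2 R).-integrable (rect c1 c2 al be) (fun z => (z.1)%:E).
  apply: (@integrable_rect _ _ _ _ _ (`|c1| + al / 2)) => // -[x y] /= [/= xc _].
  by rewrite -lerBlDl; apply: le_trans xc; exact: lerB_dist.
rewrite /bar1 rectE /leb2 integral_setX//; last by rewrite -rectE.
under eq_integral.
  move=> x _; rewrite /= integral_cst//= lebesgue_measure_itvcc; last lra.
  rewrite -EFinM; over.
rewrite (@integral_itv_quad R 0 be 0); [|lra|].
- by congr (_%:E); field.
- by move=> t _; rewrite /=; field.
Qed.

Lemma bar2_rect (R : realType) (c1 c2 al be : R) : 0 <= al -> 0 <= be ->
  bar2 (rect c1 c2 al be) = (c2 * al * be)%:E.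
Proof.
move=> al0 be0.
have intf : (@leb2 R).-integrable (rect c1 c2 al be) (fun z => (z.2)%:E).
  apply: (@integrable_rect _ _ _ _ _ (`|c2| + be / 2)) => // -[x y] /= [/= _ yc].
  by rewrite -lerBlDl; apply: le_trans yc; exact: lerB_dist.
rewrite /bar2 rectE /leb2 integral_setX//; last by rewrite -rectE.
under eq_integral do rewrite /= integral_itv_id//.
rewrite integral_cst//= lebesgue_measure_itvcc; last lra.
by rewrite -EFinM; congr (_%:E); field.
Qed.

(** The unnormalized barycentre is the centre times the area, so with area 1 the barycentre
    constraint fixes the centre. *)
Lemma admissibleP (R : realType) (c1 c2 al be : R) :
  admissible c1 c2 al be <-> [/\ 0 < al, al * be = 1, c1 = 0 & c2 = 0].
Proof.
split=> [[al0 [be0 []]]|[al0 albe -> ->]].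
  rewrite leb2_rect ?ltW// bar1_rect ?ltW// bar2_rect ?ltW//.
  move=> [albe] [] [+] [+]; rewrite -!mulrA albe !mulr1.
  by move=> -> ->; split.
have be0 : 0 < be by rewrite -(pmulr_rgt0 _ al0) albe.
by rewrite /admissible leb2_rect ?bar1_rect ?bar2_rect ?ltW// albe !mul0r.
Qed.

(** * The symmetric difference and the dissipation *)

Lemma rect0P (R : realType) (al be : R) (z : R * R) :
  rect 0 0 al be z <-> `|z.1| <= al / 2 /\ `|z.2| <= be / 2.
Proof. by rewrite /rect /= !subr0. Qed.

(** Narrowing and heightening adds strips above and below and removes strips at the sides. No corner
    regions occur, so [dinf] is explicit on each product piece. *)
Lemma symdiff_rect (R : realType) (a b al be : R) : al <= a -> b <= be ->
  symdiff (rect 0 0 al be) (rect 0 0 a b) =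
  `[- (al / 2), al / 2] `*` [set y | b / 2 < `|y| <= be / 2] `|`
  [set x | al / 2 < `|x| <= a / 2] `*` `[- (b / 2), b / 2].
Proof.
move=> ala bbe; apply/seteqP; split=> -[x y].
  move=> [[/rect0P/= [xal ybe] nF]|[/rect0P/= [xa yb] nE]].
  - left; rewrite /= in_itv /= -ler_norml; split=> //; rewrite ybe andbT ltNge.
    by apply/negP => yb; apply: nF; apply/rect0P; split=> //=; lra.
  - right; rewrite /= in_itv /= -ler_norml; split=> //; rewrite xa andbT ltNge.
    by apply/negP => xal; apply: nE; apply/rect0P; split=> //=; lra.
move=> [] /=; rewrite in_itv /= -ler_norml.
- move=> [xal /andP[yb' ybe]]; left; split; first exact/rect0P.
  by move=> /rect0P[/= _]; rewrite leNgt yb'.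
- move=> [/andP[alx xa] yb]; right; split; first exact/rect0P.
  by move=> /rect0P[/= +]; rewrite leNgt alx.
Qed.

Lemma measurable_norm_fst (R : realType) :
  measurable_fun setT (fun z : R * R => `|z.1|).
Proof. exact: (measurableT_comp (@normr_measurable R setT) measurable_fst). Qed.

Lemma measurable_norm_snd (R : realType) :
  measurable_fun setT (fun z : R * R => `|z.2|).
Proof. exact: (measurableT_comp (@normr_measurable R setT) measurable_snd). Qed.

(** Equals [dinf] to [rect 0 0 a b] for points of that rectangle; outside it the formula is
    negative. *)
Definition inner_dist (R : realType) (a b : R) (z : R * R) : R :=
  Num.min (a / 2 - `|z.1|) (b / 2 - `|z.2|).

Lemma measurable_inner_dist (R : realType) (a b : R) :
  measurable_fun setT (inner_dist a b).
Proof.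
apply: measurable_minr; apply: measurable_funB => //.
- exact: measurable_norm_fst.
- exact: measurable_norm_snd.
Qed.

(** The area of a trapezoid with bases [2 * h] and [2 * (h - s)] and height [s]; the integral is cut
    at the ends of the plateau. *)
Lemma integral_min_abs (R : realType) (s h : R) : 0 <= s <= h ->
  (\int[lebesgue_measure]_(y in `[(- h)%R, h]) (Num.min s (h - `|y|)%R)%:E =
   (2 * s * h - s ^+ 2)%:E)%E.
Proof.
move=> /andP[s0 sh].
have mf : measurable_fun setT (fun y : R => Num.min s (h - `|y|)).
  by apply: measurable_minr => //; apply: measurable_funB.
rewrite (@integral_itv_split _ _ _ (s - h))//; [|lra|lra].
rewrite (@integral_itv_split _ _ (s - h) (h - s))//; [|lra|lra].
rewrite (@integral_itv_quad R h 1 0); [|lra|]; last first.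
  move=> t /andP[t1 t2]; rewrite ler0_norm; last lra.
  by rewrite opprK min_r; lra.
rewrite (@integral_itv_quad R s 0 0); [|lra|]; last first.
  move=> t t12; rewrite min_l; first lra.
  have : `|t| <= h - s by rewrite ler_norml; lra.
  lra.
rewrite (@integral_itv_quad R h (-1) 0); [|lra|]; last first.
  move=> t /andP[t1 t2]; rewrite ger0_norm; last lra.
  by rewrite min_r; lra.
by rewrite -!EFinD; congr (_%:E); field.
Qed.

Lemma integral_inner_dist (R : realType) (a b al : R) :
  0 <= b -> 0 <= al -> a - b <= al <= a ->
  (\int[@leb2 R]_(z in [set x | (al / 2 < `|x| <= a / 2)%R] `*`
      `[(- (b / 2))%R, (b / 2)%R]) (inner_dist a b z)%:E =
   (b * ((a - al) / 2) ^+ 2 - 2 / 3 * ((a - al) / 2) ^+ 3)%:E)%E.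
Proof.
move=> b0 al0 /andP[abal ala].
have msh : measurable [set x : R | al / 2 < `|x| <= a / 2].
  by apply: measurable_shell; lra.
rewrite /leb2 integral_setX_ge0//; last 2 first.
- apply/measurable_EFinP; apply: measurable_funTS; exact: measurable_inner_dist.
- move=> [x y] [/= /andP[_ xa]]; rewrite in_itv /= -ler_norml => yb.
  by rewrite lee_fin le_min !subr_ge0 xa.
(* The vertical slice at [x] has depth [s x], and [F x] is its trapezoid area; [a - b <= al] ensures
   [s x <= b / 2]. *)
pose s (x : R) : R := a / 2 - `|x|.
pose F (x : R) : R := 2 * s x * (b / 2) - s x ^+ 2.
have ms : measurable_fun setT s.
  exact: measurable_funB.
transitivity (\int[lebesgue_measure]_(x in [set x | (al / 2 < `|x| <= a / 2)%R])
    (F x)%:E)%E.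
  apply: eq_integral => x; rewrite inE /= => /andP[alx xa].
  by apply: (@integral_min_abs R (s x) (b / 2)); rewrite /s subr_ge0 xa /=; lra.
rewrite integral_shell; last 2 first.
- apply: measurable_funB; last exact: measurable_funX.
  by apply: measurable_funM => //; exact: measurable_funM.
- lra.
rewrite (@integral_itv_quad R (a * b / 2 - a ^+ 2 / 4) (a - b) (- 1)); [|lra|].
  rewrite (@integral_itv_quad R (a * b / 2 - a ^+ 2 / 4) (b - a) (- 1)); [|lra|].
    by rewrite -EFinD; congr (_%:E); field.
  by move=> t tal; rewrite /F /s ler0_norm; [field|lra].
by move=> t tal; rewrite /F /s ger0_norm; [field|lra].
Qed.

Lemma integral_outer_dist (R : realType) (b be al : R) :
  0 <= b -> b <= be -> 0 <= al ->
  (\int[@leb2 R]_(z in `[(- (al / 2))%R, (al / 2)%R] `*`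
     [set y | (b / 2 < `|y| <= be / 2)%R]) (`|z.2| - b / 2)%:E =
   (al * ((be - b) / 2) ^+ 2)%:E)%E.
Proof.
move=> b0 bbe al0.
have msh : measurable [set y : R | b / 2 < `|y| <= be / 2].
  by apply: measurable_shell; lra.
rewrite /leb2 integral_setX_ge0//; last 2 first.
- apply/measurable_EFinP; apply: measurable_funTS; apply: measurable_funB => //.
  exact: measurable_norm_snd.
- by move=> [x y] [/= _ /andP[yb' _]]; rewrite lee_fin subr_ge0 ltW.
under eq_integral.
  move=> x _; rewrite /= (@integral_shell R (fun y => `|y| - b / 2)); last 2 first.
  - exact: measurable_funB.
  - lra.
  rewrite (@integral_itv_quad R (- (b / 2)) 1 0); [|lra|]; last first.
    by move=> t tb; rewrite ger0_norm; [field|lra].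
  rewrite (@integral_itv_quad R (- (b / 2)) (- 1) 0); [|lra|]; last first.
    by move=> t tb; rewrite ler0_norm; [field|lra].
  rewrite -EFinD; over.
rewrite integral_cst//= lebesgue_measure_itvcc; last lra.
by rewrite -EFinM; congr (_%:E); field.
Qed.

(** The side strips are left as an integral: its closed form holds only for [a - b <= al], while
    narrower rectangles are handled by monotonicity. *)
Lemma Dist_rect_split (R : realType) (a b al be : R) :
  0 <= b -> 0 <= al -> al <= a -> b <= be ->
  Dist (rect 0 0 al be) (rect 0 0 a b) =
  ((al * ((be - b) / 2) ^+ 2)%:E +
   \int[@leb2 R]_(z in [set x | (al / 2 < `|x| <= a / 2)%R] `*`
      `[(- (b / 2))%R, (b / 2)%R]) (inner_dist a b z)%:E)%E.
Proof.
move=> b0 al0 ala bbe; rewrite /Dist symdiff_rect//.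
set D1 := _ `*` _; set D2 := _ `*` _.
have mD1 : measurable D1 by apply: measurableX => //; apply: measurable_shell; lra.
have mD2 : measurable D2 by apply: measurableX => //; apply: measurable_shell; lra.
(* A single measurable formula for [dinf], valid on both parts of [symdiff]. *)
pose g (z : R * R) : R := Num.max (`|z.2| - b / 2) (inner_dist a b z).
have mg : measurable_fun setT g.
  apply: measurable_maxr; last exact: measurable_inner_dist.
  by apply: measurable_funB => //; exact: measurable_norm_snd.
have dE1 z : D1 z -> dinf z (rect 0 0 a b) = `|z.2| - b / 2.
  move=> [/=]; rewrite in_itv /= -ler_norml => xal /andP[yb' _].
  by rewrite dinf_rect_above//; lra.
have dE2 z : D2 z -> dinf z (rect 0 0 a b) = inner_dist a b z.
  move=> [/= /andP[_ xa]]; rewrite in_itv /= -ler_norml => yb.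
  by rewrite dinf_rect_inside//; lra.
have gE1 z : D1 z -> g z = `|z.2| - b / 2.
  move=> [/= _ /andP[yb' _]]; apply: max_l.
  by rewrite /inner_dist ge_min; apply/orP; right; lra.
have gE2 z : D2 z -> g z = inner_dist a b z.
  move=> [/= /andP[_ xa]]; rewrite in_itv /= -ler_norml => yb; apply: max_r.
  by rewrite /inner_dist le_min; apply/andP; split; lra.
have dE z : (D1 `|` D2) z -> dinf z (rect 0 0 a b) = g z.
  by move=> [Dz|Dz]; [rewrite dE1// gE1|rewrite dE2// gE2].
transitivity (\int[@leb2 R]_(z in D1 `|` D2) (g z)%:E)%E.
  by apply: eq_integral => z /set_mem /dE ->.
rewrite ge0_integral_setU//.
- rewrite -integral_outer_dist//; congr (_ + _)%E; apply: eq_integral => z.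
  + by rewrite inE => /gE1 ->.
  + by rewrite inE => /gE2 ->.
- by apply/measurable_EFinP; exact: measurable_funTS.
- by move=> z /dE <-; rewrite lee_fin dinf_ge0.
- apply/disj_setPS => -[x y] [[/= + _] [/= /andP[+ _] _]].
  by rewrite in_itv /= -ler_norml => xal; rewrite ltNge xal.
Qed.

Lemma Dist_rect_near (R : realType) (a b al be : R) :
  0 <= b -> 0 <= al -> a - b <= al <= a -> b <= be ->
  Dist (rect 0 0 al be) (rect 0 0 a b) =
  (al * ((be - b) / 2) ^+ 2 +
   (b * ((a - al) / 2) ^+ 2 - 2 / 3 * ((a - al) / 2) ^+ 3))%:E.
Proof.
move=> b0 al0 /andP[abal ala] bbe.
by rewrite Dist_rect_split// integral_inner_dist ?abal.
Qed.

(** The removed strips contain those removed at width [a - b], whose cost is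
    [b * (b / 2) ^+ 2 - 2 / 3 * (b / 2) ^+ 3]. *)
Lemma Dist_rect_far (R : realType) (a b al be : R) :
  0 <= b -> b <= a -> 0 <= al -> al <= a - b -> b <= be ->
  ((b ^+ 3 / 6)%:E <= Dist (rect 0 0 al be) (rect 0 0 a b))%E.
Proof.
move=> b0 ba al0 alab bbe.
rewrite Dist_rect_split//; last lra.
have /= := @integral_inner_dist R a b (a - b) b0.
rewrite lexx lerBlDr lerDl b0 subr_ge0 => /(_ ba isT) intE.
have -> : (b ^+ 3 / 6)%:E = (b * ((a - (a - b)) / 2) ^+ 2 -
    2 / 3 * ((a - (a - b)) / 2) ^+ 3)%:E by congr (_%:E); field.
rewrite -intE; apply: (@le_trans _ _ (\int[@leb2 R]_(z in
   [set x | (al / 2 < `|x| <= a / 2)%R] `*` `[(- (b / 2))%R, (b / 2)%R])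
   (inner_dist a b z)%:E)%E).
  apply: ge0_subset_integral.
  - by apply: measurableX => //; apply: measurable_shell; lra.
  - by apply: measurableX => //; apply: measurable_shell; lra.
  - apply/measurable_EFinP; apply: measurable_funTS; exact: measurable_inner_dist.
  - move=> [x y] [/= /andP[_ xa]]; rewrite in_itv /= -ler_norml => yb.
    by rewrite lee_fin le_min !subr_ge0 xa.
  - move=> [x y] [/= /andP[abx xa] yb]; split=> //=; apply/andP; split=> //.
    by apply: le_lt_trans abx; lra.
by rewrite leeDr// lee_fin mulr_ge0// sqr_ge0.
Qed.

Lemma Dist_ge0 (R : realType) (E F : set (R * R)) : (0 <= Dist E F)%E.
Proof. by apply: integral_ge0 => z _; rewrite lee_fin dinf_ge0. Qed.

Lemma Dist_self (R : realType) (F : set (R * R)) : Dist F F = 0%E.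
Proof. by rewrite /Dist /symdiff setDv setU0 integral_set0. Qed.

Lemma lebesgue_measure_shell (R : realType) (h k : R) : 0 <= h <= k ->
  lebesgue_measure [set t | h < `|t| <= k] = (2 * (k - h))%:E.
Proof.
move=> /andP[h0 hk]; have := @integral_shell R (cst 1) h k.
rewrite /cst !integral_cst//=; last exact: measurable_shell.
rewrite !mul1e => -> //; rewrite !lebesgue_measure_itvcc//; last lra.
by rewrite -EFinD; congr (_%:E); field.
Qed.

Lemma leb2_symdiff_rect_le (R : realType) (a b al be : R) :
  0 <= b -> 0 <= al -> al <= a -> b <= be ->
  (leb2 (symdiff (rect 0 0 a b) (rect 0 0 al be)) <=
   (al * (be - b) + (a - al) * b)%:E)%E.
Proof.
move=> b0 al0 ala bbe.
rewrite /symdiff setUC -/(symdiff _ _) symdiff_rect//.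
set D1 := _ `*` _; set D2 := _ `*` _.
have msh1 : measurable [set y : R | b / 2 < `|y| <= be / 2].
  by apply: measurable_shell; lra.
have msh2 : measurable [set x : R | al / 2 < `|x| <= a / 2].
  by apply: measurable_shell; lra.
have E1 : leb2 D1 = (al * (be - b))%:E.
  transitivity (lebesgue_measure `[(- (al / 2))%R, (al / 2)%R] *
    lebesgue_measure [set y | (b / 2 < `|y| <= be / 2)%R])%E.
    exact: product_measure1E.
  rewrite lebesgue_measure_itvcc ?lebesgue_measure_shell; [|lra..].
  by rewrite -EFinM; congr (_%:E); field.
have E2 : leb2 D2 = ((a - al) * b)%:E.
  transitivity (lebesgue_measure [set x | (al / 2 < `|x| <= a / 2)%R] *
    lebesgue_measure `[(- (b / 2))%R, (b / 2)%R])%E.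
    exact: product_measure1E.
  rewrite lebesgue_measure_itvcc ?lebesgue_measure_shell; [|lra..].
  by rewrite -EFinM; congr (_%:E); field.
rewrite EFinD -E1 -E2; apply: measureU2; exact: measurableX.
Qed.

(** * The stationarity equation and its consequences *)

(** The equation is [tau] times the derivative in [x] of the energy at width [a - 2 * x]; clearing
    denominators makes it polynomial. *)
Lemma stationary_point (R : realType) (a b tau : R) :
  0 < b -> b <= a -> a * b = 1 -> 0 < tau -> 16 * tau <= b ^+ 2 ->
  exists x : R, [/\ 0 <= x, x * b <= 4 * tau, 0 < a - 2 * x &
    4 * tau * ((a - 2 * x)^-1 ^+ 2 - 1) + 2 * b * x - 2 * x ^+ 2 +
    2 * b ^+ 2 * x * ((a - 2 * x)^-1 + x * (a - 2 * x)^-1 ^+ 2) = 0].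
Proof.
move=> b0 ba ab tau0 taub.
have a1 : 1 <= a by nra.
(* The derivative of the energy times [tau * (a - 2 x)^2]. *)
pose H : {poly R} := (4 * tau) *: (1 - (a%:P - 2 *: 'X) ^+ 2) +
  ((2 * b) *: 'X - 2 *: 'X ^+ 2) * (a%:P - 2 *: 'X) ^+ 2 +
  (2 * b ^+ 2) *: ('X * (a%:P - 'X)).
have HE x : H.[x] = 4 * tau * (1 - (a - 2 * x) ^+ 2) +
  (2 * b * x - 2 * x ^+ 2) * (a - 2 * x) ^+ 2 + 2 * b ^+ 2 * (x * (a - x)).
  by rewrite /H !hornerE /=; ring.
(* At this endpoint [2 * b * x1 = 8 * tau], which outweighs both [4 * tau] and [2 * x1 ^+ 2], the
   latter being at most [2 * tau]. *)
set x1 := 4 * tau / b.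
have x1b : x1 * b = 4 * tau by rewrite /x1 divfK// gt_eqF.
have x10 : 0 < x1 by rewrite /x1 divr_gt0// mulr_gt0.
have x1b4 : 4 * x1 <= b by rewrite -(ler_pM2r b0) -mulrA x1b; lra.
have a2 : 1 <= a ^+ 2 by nra.
have H0 : H.[0] <= 0 by rewrite HE; nra.
have H1 : 0 <= H.[x1].
  rewrite HE.
  have -> : 4 * tau * (1 - (a - 2 * x1) ^+ 2) +
      (2 * b * x1 - 2 * x1 ^+ 2) * (a - 2 * x1) ^+ 2 + 2 * b ^+ 2 * (x1 * (a - x1)) =
    4 * tau + (2 * b * x1 - 2 * x1 ^+ 2 - 4 * tau) * (a - 2 * x1) ^+ 2 +
      2 * b ^+ 2 * (x1 * (a - x1)) by ring.
  have bb : 0 <= 2 * b ^+ 2 by rewrite mulr_ge0 ?sqr_ge0.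
  apply: addr_ge0; last by apply: mulr_ge0 => //; apply: mulr_ge0; lra.
  apply: addr_ge0; first lra.
  by rewrite mulr_ge0 ?sqr_ge0//; nra.
have [] := @poly_ivt R H 0 x1; rewrite ?H0 ?H1 ?ltW//.
move=> x /andP[x0 xx1] /rootP; rewrite HE => Hx0.
have A0 : 0 < a - 2 * x by lra.
exists x; split=> //; first by rewrite -x1b ler_wpM2r// ltW.
have An : a - 2 * x != 0 by rewrite gt_eqF.
apply: (mulIf (expf_neq0 2 An)); rewrite mul0r -Hx0; field; exact: An.
Qed.

(** Both sides are [tau] times energies. The bounds by [b] keep [b x^2 - (2/3) x^3] in its convex
    range, and [x^2 / (a - 2 x)] is convex as a quadratic over a positive linear function. *)
Lemma energy_tangent_lt (R : realType) (a b tau x0 x : R) :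
  0 < tau -> 0 < a - 2 * x0 -> 0 < a - 2 * x ->
  2 * x0 <= b -> 2 * x <= b ->
  4 * tau * ((a - 2 * x0)^-1 ^+ 2 - 1) + 2 * b * x0 - 2 * x0 ^+ 2 +
    2 * b ^+ 2 * x0 * ((a - 2 * x0)^-1 + x0 * (a - 2 * x0)^-1 ^+ 2) = 0 ->
  x != x0 ->
  tau * (2 * (a - 2 * x0) + 2 * (a - 2 * x0)^-1) +
    (b * x0 ^+ 2 - 2 / 3 * x0 ^+ 3 + b ^+ 2 * x0 ^+ 2 * (a - 2 * x0)^-1) <
  tau * (2 * (a - 2 * x) + 2 * (a - 2 * x)^-1) +
    (b * x ^+ 2 - 2 / 3 * x ^+ 3 + b ^+ 2 * x ^+ 2 * (a - 2 * x)^-1).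
Proof.
move=> tau0 A0 A x0b xb stat xx0; rewrite -subr_gt0.
have A0n : a - 2 * x0 != 0 by rewrite gt_eqF.
have An : a - 2 * x != 0 by rewrite gt_eqF.
set lhs := (X in 0 < X).
(* First-order Taylor expansion at [x0]: each remainder below is nonnegative by
   convexity, and that of the perimeter is positive. *)
have -> : lhs = (x - x0) * (4 * tau * ((a - 2 * x0)^-1 ^+ 2 - 1) + 2 * b * x0 -
      2 * x0 ^+ 2 +
      2 * b ^+ 2 * x0 * ((a - 2 * x0)^-1 + x0 * (a - 2 * x0)^-1 ^+ 2)) +
    (8 * tau * ((x - x0) / (a - 2 * x0)) ^+ 2 / (a - 2 * x) +
     ((x - x0) ^+ 2 * (b - (4 * x0 + 2 * x) / 3) +
      b ^+ 2 * (a - 2 * x) * (x / (a - 2 * x) - x0 / (a - 2 * x0)) ^+ 2)).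
  by rewrite /lhs; field; rewrite A0n.
rewrite stat mulr0 add0r ltr_pwDl//.
- rewrite divr_gt0// mulr_gt0//; first lra.
  by rewrite exprn_even_gt0//= mulf_neq0 ?invr_eq0// subr_eq0.
- apply: addr_ge0; first by apply: mulr_ge0; [exact: sqr_ge0|lra].
  by apply: mulr_ge0; [apply: mulr_ge0; [exact: sqr_ge0|lra]|exact: sqr_ge0].
Qed.

(** Replacing [(a - 2 * x)^-1] by [a^-1 = b] and dropping [x ^+ 2] leaves a linear equation whose
    root is the claimed first-order term; [L] bounds [b^-1]. *)
Lemma stationary_expansion (R : realType) (a b tau x L : R) :
  0 < b -> a * b = 1 -> b <= 1 -> 0 < tau -> 1 <= L -> 1 <= b * L ->
  0 <= x -> x * b <= 4 * tau -> 4 * x <= b ->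
  4 * tau * ((a - 2 * x)^-1 ^+ 2 - 1) + 2 * b * x - 2 * x ^+ 2 +
    2 * b ^+ 2 * x * ((a - 2 * x)^-1 + x * (a - 2 * x)^-1 ^+ 2) = 0 ->
  `|x - 2 * (a - b) / (b * (a + b)) * tau| <= 224 * L ^+ 3 * tau ^+ 2.
Proof.
move=> b0 ab b1 tau0 L1 bL x0 xb x4 stat.
have a1 : 1 <= a by nra.
have A0 : 0 < a - 2 * x by lra.
set p := (a - 2 * x)^-1 in stat.
have pA : p * (a - 2 * x) = 1 by rewrite /p mulVf// gt_eqF.
have p0 : 0 < p by rewrite /p invr_gt0.
have pb : p - b = 2 * x * p * b by nra.
have p2b : p <= 2 * b by nra.
set d := x - _.
(* The linear equation has slope [2 * b * (1 + b ^+ 2)]; the right side collects the errors, all of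
   order [tau * x] or [x ^+ 2]. *)
have dE : 2 * b * (1 + b ^+ 2) * d =
  - (4 * tau * (p ^+ 2 - b ^+ 2) - 2 * x ^+ 2 +
     2 * b ^+ 2 * x * (p - b + x * p ^+ 2)).
  have -> : d = x - 2 * (1 - b ^+ 2) / (b * (1 + b ^+ 2)) * tau.
    rewrite /d; have -> : a = b^-1 by rewrite -[LHS]mulr1 -(mulfV (lt0r_neq0 b0)) mulrA ab mul1r.
    by field; rewrite !gt_eqF//; nra.
  have -> : 2 * b * (1 + b ^+ 2) *
      (x - 2 * (1 - b ^+ 2) / (b * (1 + b ^+ 2)) * tau) =
    2 * b * (1 + b ^+ 2) * x - 4 * tau * (1 - b ^+ 2).
    by field; rewrite !gt_eqF//; nra.
  lra.
have p2 : p <= 2 by lra.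
have pble : p * b <= 2 by nra.
have pbge : 0 <= p * b by nra.
have pb4 : 0 <= p - b <= 4 * x by rewrite pb; nra.
have pb12 : 0 <= p ^+ 2 - b ^+ 2 <= 12 * x.
  have -> : p ^+ 2 - b ^+ 2 = (p - b) * (p + b) by ring.
  nra.
have pp : 0 <= p ^+ 2 <= 4 by nra.
have xp : 0 <= x * p ^+ 2 <= 4 * x by nra.
have remle : `|2 * b * (1 + b ^+ 2) * d| <= 48 * tau * x + 16 * x ^+ 2.
  have bb : 0 <= b ^+ 2 <= 1 by nra.
  set u := p ^+ 2 - b ^+ 2 in pb12 dE; set v := p - b + x * p ^+ 2 in dE.
  have v8 : 0 <= v <= 8 * x by rewrite /v; lra.
  have bxv : 0 <= b ^+ 2 * x * v <= 8 * x ^+ 2.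
    have xv : 0 <= x * v <= 8 * x ^+ 2 by nra.
    by rewrite -mulrA; nra.
  have tu : 0 <= tau * u <= 12 * (tau * x) by nra.
  by rewrite dE normrN ler_norml; lra.
have d0 : 0 <= `|d| by [].
(* Multiplying by [b ^+ 2] allows [x * b <= 4 * tau] to be used: 48 * 4 + 16 * 16 = 448, and half of
   it is 224. *)
have key : b ^+ 3 * `|d| <= 224 * tau ^+ 2.
  have c0 : 0 <= 2 * b * (1 + b ^+ 2) by rewrite !mulr_ge0 ?addr_ge0 ?sqr_ge0 ?ltW.
  move: remle; rewrite normrM (ger0_norm c0) => remle.
  have lower : 2 * (b ^+ 3 * `|d|) <= b ^+ 2 * (2 * b * (1 + b ^+ 2) * `|d|).
    rewrite -subr_ge0 (_ : _ - _ = 2 * b ^+ 5 * `|d|); last by ring.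
    by rewrite !mulr_ge0 ?exprn_ge0 ?normr_ge0 // ltW.
  have upper : b ^+ 2 * (48 * tau * x + 16 * x ^+ 2) <= 448 * tau ^+ 2.
    rewrite (_ : _ * _ = 48 * (tau * (b * (x * b))) + 16 * (x * b) ^+ 2); last by ring.
    have xb0 : 0 <= x * b by nra.
    have bxb : b * (x * b) <= 4 * tau by nra.
    nra.
  have mid := ler_wpM2l (sqr_ge0 b) remle.
  lra.
have bL3 : 1 <= (b * L) ^+ 3 by rewrite exprn_ege1.
have L3 : 0 <= L ^+ 3 by rewrite exprn_ge0//; lra.
apply: (@le_trans _ _ ((b * L) ^+ 3 * `|d|)); first by rewrite ler_peMl.
rewrite (_ : _ * `|d| = L ^+ 3 * (b ^+ 3 * `|d|)); last by ring.
rewrite (_ : 224 * _ * _ = L ^+ 3 * (224 * tau ^+ 2)); last by ring.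
exact: ler_wpM2l.
Qed.

(** * Comparison of energies *)

(** By [a * b = 1] the added strips have thickness [b * x / (a - 2 * x)], whence the last term.
    Factoring out [tau^-1] matches [energy_tangent_lt]. *)
Lemma energy_near (R : realType) (tau a b x : R) :
  0 < tau -> 0 < b -> a * b = 1 -> 0 <= x -> 2 * x <= b -> 0 < a - 2 * x ->
  energy tau (rect 0 0 a b) 0 0 (a - 2 * x) (a - 2 * x)^-1 =
  (tau^-1 * (tau * (2 * (a - 2 * x) + 2 * (a - 2 * x)^-1) +
    (b * x ^+ 2 - 2 / 3 * x ^+ 3 + b ^+ 2 * x ^+ 2 * (a - 2 * x)^-1)))%:E.
Proof.
move=> tau0 b0 ab x0 xb A0; have An : a - 2 * x != 0 by rewrite gt_eqF.
have bE : (a - 2 * x)^-1 - b = 2 * x * (b / (a - 2 * x)).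
  have -> : (a - 2 * x)^-1 - b = (1 - b * (a - 2 * x)) / (a - 2 * x) by field.
  by rewrite mulrBr [b * a]mulrC ab; field.
have bp : 0 <= (a - 2 * x)^-1 - b.
  by rewrite bE !mulr_ge0 ?invr_ge0 // ltW.
rewrite /energy Dist_rect_near; [|lra..].
rewrite -EFinM -EFinD; congr (_%:E); rewrite bE.
by rewrite /perim_rect; field; rewrite An gt_eqF.
Qed.

(** The height drops by [be * b] times the gain in width, and [be * b < 1]. *)
Lemma perim_gt (R : realType) (a b al be : R) :
  0 < b -> b <= 1 -> 1 <= a -> a * b = 1 -> a < al -> al * be = 1 ->
  a + b < al + be.
Proof.
move=> b0 b1 a1 ab aal albe.
have al0 : 0 < al by lra.
have be0 : 0 < be by rewrite -(pmulr_rgt0 _ al0) albe.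
have be1 : be < 1 by nra.
have E : be - b = be * b * (a - al).
  transitivity (be * (a * b) - b * (al * be)); last by ring.
  by rewrite ab albe !mulr1.
have bb : be * b < 1 by nra.
nra.
Qed.

Lemma energy_minimizer (R : realType) (a b tau x : R) :
  0 < b -> b <= 1 -> b <= a -> a * b = 1 -> 0 < tau -> 24 * tau <= b ^+ 4 ->
  0 <= x -> 4 * x <= b ->
  4 * tau * ((a - 2 * x)^-1 ^+ 2 - 1) + 2 * b * x - 2 * x ^+ 2 +
    2 * b ^+ 2 * x * ((a - 2 * x)^-1 + x * (a - 2 * x)^-1 ^+ 2) = 0 ->
  ((energy tau (rect 0 0 a b) 0 0 (a - 2 * x) (a - 2 * x)^-1 <=
    (2 * a + 2 * b)%:E)%E) /\
  forall al be : R, 0 < al -> al * be = 1 -> al != a - 2 * x ->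
  (energy tau (rect 0 0 a b) 0 0 (a - 2 * x) (a - 2 * x)^-1 <
   energy tau (rect 0 0 a b) 0 0 al be)%E.
Proof.
move=> b0 b1 ba ab tau0 taub x0 x4 stat.
have a1 : 1 <= a by nra.
have a0 : 0 < a by lra.
have A0 : 0 < a - 2 * x by lra.
have beE (al be : R) : 0 < al -> al * be = 1 -> be = al^-1.
  move=> al0 albe; have aln := lt0r_neq0 al0.
  by apply: (mulfI aln); rewrite albe mulfV.
have near (y : R) : 0 <= y -> 2 * y <= b -> 0 < a - 2 * y -> y != x ->
    (energy tau (rect 0 0 a b) 0 0 (a - 2 * x) (a - 2 * x)^-1 <
     energy tau (rect 0 0 a b) 0 0 (a - 2 * y) (a - 2 * y)^-1)%E.
  move=> y0 yb Ay yx; rewrite !energy_near//; last lra.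
  by rewrite lte_fin ltr_pM2l ?invr_gt0// energy_tangent_lt//; lra.
(* The original rectangle is the competitor [y = 0], with zero dissipation. *)
have start : (energy tau (rect 0 0 a b) 0 0 (a - 2 * x) (a - 2 * x)^-1 <=
    (2 * a + 2 * b)%:E)%E.
  have <- : energy tau (rect 0 0 a b) 0 0 (a - 2 * 0) (a - 2 * 0)^-1 =
      (2 * a + 2 * b)%:E.
    rewrite mulr0 subr0 -(beE _ b)// /energy Dist_self mule0 adde0 //.
  have [->//|nx] := eqVneq x 0.
  by apply/ltW/near; rewrite ?mulr0 ?subr0 1?eq_sym// ltW.
split=> // al be al0 albe alx.
have be0 : 0 < be by rewrite -(pmulr_rgt0 _ al0) albe.
have energy_ge (c : R) : (c%:E <= Dist (rect 0 0 al be) (rect 0 0 a b))%E ->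
    ((2 * al + 2 * be + tau^-1 * c)%:E <=
     energy tau (rect 0 0 a b) 0 0 al be)%E.
  move=> cD; rewrite /energy /perim_rect EFinD leeD2l// EFinM lee_wpmul2l//.
  by rewrite lee_fin invr_ge0 ltW.
have [ala|aal] := leP al a; last first.
  have := energy_ge 0 (Dist_ge0 _ _); rewrite mulr0 addr0.
  apply: lt_le_trans; apply: le_lt_trans start _.
  by rewrite lte_fin; have := perim_gt b0 b1 a1 ab aal albe; lra.
have bbe : b <= be by nra.
have [abal|alab] := leP (a - b) al.
  pose y := (a - al) / 2.
  have alE : al = a - 2 * y by rewrite /y; field.
  have y0 : 0 <= y by rewrite /y; lra.
  have yb : 2 * y <= b by rewrite /y; lra.
  have yx : y != x by apply: contraNneq alx => <-; apply/eqP.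
  have Ay : 0 < a - 2 * y by rewrite -alE.
  by rewrite (beE _ _ al0 albe) alE; exact: near.
have := energy_ge _ (Dist_rect_far (ltW b0) ba (ltW al0) (ltW alab) bbe).
apply: lt_le_trans; apply: le_lt_trans start _; rewrite lte_fin.
(* Here [24 * tau <= b ^+ 4] enters: [b ^+ 3 / 6 = a * b ^+ 4 / 6] is at least [4 * a * tau], and
   [b <= a]. *)
have far : 2 * a + 2 * b <= tau^-1 * (b ^+ 3 / 6).
  rewrite [leRHS]mulrC ler_pdivlMr//.
  have -> : b ^+ 3 / 6 = a * (b ^+ 4 / 6).
    by transitivity (a * b * (b ^+ 3 / 6)); [rewrite ab mul1r|ring].
  have := ler_wpM2l (ltW a0) taub; nra.
lra.
Qed.

(** * Uniform constants and conclusion *)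

Theorem theorem2p8 (R : realType) (Lam : R) :
  exists tau0 C : R, 0 < tau0 /\ 0 < C /\
  forall a b : R, 0 < b -> b <= a -> a * b = 1 -> a + b < Lam ->
  forall tau : R, 0 < tau -> tau < tau0 ->
  exists a' b' : R,
    (* R' = rect 0 0 a' b' is an admissible minimizer ... *)
    admissible 0 0 a' b' /\
    (forall c1 c2 al be, admissible c1 c2 al be ->
       (energy tau (rect 0 0 a b) 0 0 a' b' <= energy tau (rect 0 0 a b) c1 c2 al be)%E) /\
    (* ... and it is the unique one *)
    (forall c1 c2 al be, admissible c1 c2 al be ->
       (energy tau (rect 0 0 a b) c1 c2 al be <= energy tau (rect 0 0 a b) 0 0 a' b')%E ->
       [/\ c1 = 0, c2 = 0, al = a' & be = b']) /\
    (let x := (a - a') / 2 in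
     let x' := 2 * (a - b) / (b * (a + b)) in
     `|x - x' * tau| <= C * tau ^+ 2 /\
     b' = b + 2 * (b * x / (a - 2 * x))) /\
    a' + b' <= a + b /\
    `|a' - a| <= tau * C /\
    `|b' - b| <= tau * C /\
    (leb2 (symdiff (rect 0 0 a b) (rect 0 0 a' b')) <= (tau * C)%:E)%E.
Proof.
(* [L] is at least 1 for every [Lam], and bounds both [a] and [b^-1 = a]. *)
pose L : R := `|Lam| + 1.
have L1 : 1 <= L by rewrite /L lerDr.
have L0 : 0 < L by exact: lt_le_trans L1.
(* The first constant forces [24 * tau <= b ^+ 4]; the second comes from [stationary_expansion] and
   also dominates the [16 * L] of the linear estimates. *)
exists (24 * L ^+ 4)^-1, (224 * L ^+ 3).
split; first by rewrite invr_gt0 mulr_gt0 ?exprn_gt0.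
split; first by rewrite mulr_gt0 ?exprn_gt0.
move=> a b b0 ba ab abL tau tau0 tauL.
have b1 : b <= 1 by nra.
have a1 : 1 <= a by nra.
have aL : a <= L by rewrite /L; have := ler_norm Lam; lra.
have bL : 1 <= b * L by rewrite -ab mulrC ler_wpM2l// ltW.
have taub : 24 * tau <= b ^+ 4.
  have L4 : 0 < 24 * L ^+ 4 by rewrite mulr_gt0 ?exprn_gt0.
  move: tauL; rewrite -(ltr_pM2r L4) mulVf ?gt_eqF// => tauL.
  have bL4 : 1 <= (b * L) ^+ 4 by rewrite exprn_ege1.
  rewrite -(ler_pM2r (exprn_gt0 4 L0)) -exprMn; apply: le_trans bL4; lra.
have b42 : b ^+ 4 <= b ^+ 2 by rewrite ler_wiXn2l// ltW.
have [|x [x0 xb A0 stat]] := stationary_point b0 ba ab tau0; first lra.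
have x4 : 4 * x <= b.
  rewrite -(ler_pM2r b0) -mulrA; lra.
have [start better] := energy_minimizer b0 b1 ba ab tau0 taub x0 x4 stat.
set b' := (a - 2 * x)^-1 in stat start better.
have An : a - 2 * x != 0 by rewrite gt_eqF.
have ab' : (a - 2 * x) * b' = 1 by rewrite /b' mulfV.
have b'E : b' - b = 2 * x * (b' * b).
  have -> : b' - b = (a * b) * b' - ((a - 2 * x) * b') * b by rewrite ab ab' !mul1r.
  by ring.
have b'0 : 0 < b' by rewrite invr_gt0.
have b'2 : b' <= 2 * b by nra.
have bb' : b' * b <= 2 by nra.
have bb'0 : 0 < b' * b by exact: mulr_gt0.
have xL : x <= 4 * tau * L.
  have xbL : x * 1 <= x * (b * L) by rewrite ler_wpM2l.
  have := ler_wpM2r (ltW L0) xb; lra.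
have tauC : 16 * tau * L <= tau * (224 * L ^+ 3).
  have LL : L <= L ^+ 3 by rewrite ler_eXnr.
  have := ler_wpM2l (ltW tau0) LL; nra.
have tL0 : 0 <= tau * L by rewrite mulr_ge0 ?ltW.
have xE : (a - (a - 2 * x)) / 2 = x by field.
exists (a - 2 * x), b'.
split; [|split; [|split; [|split; [|split; [|split; [|split]]]]]].
- by apply/admissibleP; split.
- move=> c1 c2 al be /admissibleP[al0 albe -> ->].
  have [alE|/(better _ _ al0 albe)/ltW//] := eqVneq al (a - 2 * x).
  rewrite alE (_ : be = b')//; apply: (mulfI An); rewrite ab' -alE//.
- move=> c1 c2 al be /admissibleP[al0 albe -> ->].
  have [alE _|/(better _ _ al0 albe)] := eqVneq al (a - 2 * x).
    by split=> //; apply: (mulfI An); rewrite ab' -alE.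
  by rewrite ltNge => /negbTE ->.
- rewrite /= xE; split; first exact: stationary_expansion stat.
  by rewrite -[LHS](subrK b) b'E /b'; field.
(* The perimeter is at most the minimal energy, hence at most the energy of the original
   rectangle. *)
- have := Dist_ge0 (rect 0 0 (a - 2 * x) b') (rect 0 0 a b) => D0.
  have : ((2 * (a - 2 * x) + 2 * b')%:E <= (2 * a + 2 * b)%:E)%E.
    apply: le_trans start; rewrite /energy /perim_rect leeDl//.
    by rewrite mule_ge0// lee_fin invr_ge0 ltW.
  rewrite lee_fin; lra.
- by rewrite ler_norml; apply/andP; split; lra.
- by rewrite b'E ger0_norm; nra.
(* With both areas equal to 1 the bound on the measure is exactly [4 * x * b]. *)
- apply: (le_trans (leb2_symdiff_rect_le (ltW b0) (ltW A0) _ _)); [lra|nra|].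
  rewrite lee_fin mulrBr ab'; nra.
Qed.
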